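(* Let $\widehat{x}\in\mathbb{R}^{n}$ be a state estimate with associated covariance matrix $P\in\mathbb{R}^{n\times n}$, let $\chi_1,\dots,\chi_{2n}\in\mathbb{R}^n$ be the sigma points generated from $(\widehat{x},P)$, with weights $w_i=\frac{1}{2n}$, and let $g:\mathbb{R}^n\to\mathbb{R}^p$ be an arbitrary (nonlinear) function. Then statistical linear regression applied to $g$ yields results equivalent to those of the unscented transformation of $g$ using these sigma points; that is, the posterior mean and posterior covariance matrix of $y$ obtained from the statistically linearized model, $$\widehat{y}=\widehat{A}\,\overline{x}+\widehat{b},\qquad \widehat{A}P_{xx}\widehat{A}^T+P_{\zeta\zeta},$$ are equal respectively to the mean and covariance matrix given by the unscented transformation, $$\sum_{i=1}^{2n}w_i\,g(\chi_i),\qquad \sum_{i=1}^{2n}w_i\,(g(\chi_i)-\overline{y})(g(\chi_i)-\overline{y})^T .$$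
   Context: Sigma points: given $\widehat{x}\in\mathbb{R}^n$ and a covariance matrix $P$, let $\sqrt{nP}$ denote a matrix square root, i.e. a matrix $L$ with $LL^T=nP$, with columns $(\sqrt{nP})_i$, $i=1,\dots,n$. The $2n$ sigma points are $\widehat{x}\pm(\sqrt{nP})_i$, $i=1,\dots,n$, each with weight $w_i=\frac{1}{2n}$; they are listed as $\chi_1,\dots,\chi_{2n}$. Write $\gamma_i=g(\chi_i)$, $\overline{x}=\sum_{i=1}^{2n}w_i\chi_i$, $\overline{y}=\sum_{i=1}^{2n}w_i\gamma_i$, and $P_{xx}=\sum_{i=1}^{2n}w_i(\chi_i-\overline{x})(\chi_i-\overline{x})^T$. Unscented transformation of $g$: the mean and covariance of $y=g(x)$ are taken to be $\overline{y}$ and $\sum_{i}w_i(\gamma_i-\overline{y})(\gamma_i-\overline{y})^T$. Statistical linear regression (statistical linearization) of $g$: the function $y=g(x)$ is represented as $y=Ax+b+\zeta$, where $(\widehat{A},\widehat{b})\in\mathbb{R}^{p\times n}\times\mathbb{R}^p$ minimizes $\sum_{i=1}^{2n}w_i\zeta_i^T\zeta_i$ with $\zeta_i=\gamma_i-(A\chi_i+b)$. The linearization error covariance matrix is $P_{\zeta\zeta}=\sum_{i=1}^{2n}w_i\widehat{\zeta}_i\widehat{\zeta}_i^T$ with $\widehat{\zeta}_i=\gamma_i-(\widehat{A}\chi_i+\widehat{b})$. The posterior mean and covariance of $y$ from the linearized model are $\widehat{A}\overline{x}+\widehat{b}$ and $\widehat{A}P_{xx}\widehat{A}^T+P_{\zeta\zeta}$.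 *)

(* Defs.v *)
From HB Require Import structures.
From mathcomp Require Import all_boot all_order all_algebra.
From mathcomp Require Import reals.

Set Implicit Arguments.
Unset Strict Implicit.
Unset Printing Implicit Defensive.

Import Order.TTheory GRing.Theory Num.Theory.
Local Open Scope ring_scope.

(* Only semidefiniteness is required: a covariance matrix may be singular. *)
Definition covariance_matrix (R : realType) (n : nat) (P : 'M[R]_n) : Prop :=
  P^T = P /\ forall v : 'cV[R]_n, 0 <= (v^T *m P *m v) 0 0.

Definition matrix_sqrt (R : realType) (n : nat) (M L : 'M[R]_n) : Prop :=
  L *m L^T = M.

(* The 2n sigma points: indices i < n give xhat + L_i, and indices n + i give
   xhat - L_i, where L_i is the i-th column of the square root L of n P. *)
Definition sigma_point (R : realType) (n : nat) (xhat : 'cV[R]_n) (L : 'M[R]_n)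
    (i : 'I_(n + n)) : 'cV[R]_n :=
  match split i with
  | inl j => xhat + col j L
  | inr j => xhat - col j L
  end.

Definition sigma_weight (R : realType) (n : nat) (i : 'I_(n + n)) : R :=
  ((2 * n)%N%:R)^-1.

Section WeightedSamples.
Variables (R : realType) (N n p : nat) (w : 'I_N -> R).

Definition wmean (d : nat) (z : 'I_N -> 'cV[R]_d) : 'cV[R]_d :=
  \sum_(i < N) w i *: z i.

Definition wcov (d : nat) (z : 'I_N -> 'cV[R]_d) : 'M[R]_d :=
  \sum_(i < N) w i *: ((z i - wmean z) *m (z i - wmean z)^T).

Variables (chi : 'I_N -> 'cV[R]_n) (g : 'cV[R]_n -> 'cV[R]_p).

Definition ut_mean : 'cV[R]_p := wmean (fun i => g (chi i)).

Definition ut_cov : 'M[R]_p := wcov (fun i => g (chi i)).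

Definition slr_residual (A : 'M[R]_(p, n)) (b : 'cV[R]_p) (i : 'I_N) :
  'cV[R]_p := g (chi i) - (A *m chi i + b).

Definition slr_cost (A : 'M[R]_(p, n)) (b : 'cV[R]_p) : R :=
  \sum_(i < N) w i * ((slr_residual A b i)^T *m slr_residual A b i) 0 0.

(* A minimizer need not be unique when the covariance of chi is singular. *)
Definition slr_minimizer (A : 'M[R]_(p, n)) (b : 'cV[R]_p) : Prop :=
  forall (A' : 'M[R]_(p, n)) (b' : 'cV[R]_p), slr_cost A b <= slr_cost A' b'.

(* The residuals are not centred at their mean. *)
Definition slr_error_cov (A : 'M[R]_(p, n)) (b : 'cV[R]_p) : 'M[R]_p :=
  \sum_(i < N) w i *: (slr_residual A b i *m (slr_residual A b i)^T).

Definition slr_mean (A : 'M[R]_(p, n)) (b : 'cV[R]_p) : 'cV[R]_p :=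
  A *m wmean chi + b.

Definition slr_cov (A : 'M[R]_(p, n)) (b : 'cV[R]_p) : 'M[R]_p :=
  A *m wcov chi *m A^T + slr_error_cov A b.

End WeightedSamples.

(* Main.v *)
(** At a minimizer the derivative of the cost vanishes in every direction
    [(D, d)], which says that the weighted residuals sum to zero and are
    uncorrelated with the samples (the normal equations).  The first fact gives
    the equality of the means; by the second, the cross terms in the expansion
    of the covariance of [g chi_i = A chi_i + b + zeta_i] disappear. *)
Require Import Defs.
From HB Require Import structures.
From mathcomp Require Import all_boot all_order all_algebra.
From mathcomp Require Import reals ring lra.

Import Order.TTheory GRing.Theory Num.Theory.
Local Open Scope ring_scope.

(** Near [t = 0] the linear term dominates, so a nonzero [a] would make the expression negative at
    some small [t] of the sign of [a]. *)
Lemma quadratic_ge0_linear_coef_eq0 (R : realFieldType) (a c : R) :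
  (forall t, 0 <= t ^+ 2 * c - 2 * t * a) -> a = 0.
Proof.
move=> quad_ge0; apply/eqP/negPn/negP => a_neq0.
have k_gt0 : 0 < 1 + `|c| by rewrite ltr_pwDl.
(* At [t = a * s] the value is [a ^+ 2 * (s * (s * c - 2))]; this [s] ensures [s * c <= 1] whatever
   the sign of [c], so the last factor is negative. *)
pose s := (1 + `|c|)^-1.
have s_gt0 : 0 < s by rewrite invr_gt0.
have sc_le1 : s * c <= 1.
  by rewrite mulrC ler_pdivrMr // mul1r (le_trans (ler_norm c)) // lerDr.
have := quad_ge0 (a * s).
have -> : (a * s) ^+ 2 * c - 2 * (a * s) * a = a ^+ 2 * (s * (s * c - 2)) by ring.
rewrite pmulr_rge0 ?exprn_even_gt0 // pmulr_rge0 //; lra.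
Qed.

Lemma sigma_weight_sum (R : realType) (n : nat) :
  (0 < n)%N -> \sum_(i < n + n) @sigma_weight R n i = 1.
Proof.
move=> n_gt0; rewrite /sigma_weight sumr_const card_ord -[LHS]mulr_natl.
by rewrite addnn -mul2n divff // pnatr_eq0 muln_eq0 -lt0n.
Qed.

Section NormalEquations.
Variables (R : realType) (N n p : nat) (w : 'I_N -> R).
Variables (chi : 'I_N -> 'cV[R]_n) (g : 'cV[R]_n -> 'cV[R]_p).
Variables (A : 'M[R]_(p, n)) (b : 'cV[R]_p).

Local Notation r := (slr_residual chi g A b).

(** The residual is affine in the parameters, so the expansion stops exactly at order two; the
    coefficient of [t] is the directional derivative. *)
Lemma slr_cost_perturb (D : 'M[R]_(p, n)) (d : 'cV[R]_p) (t : R) :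
  let e i := D *m chi i + d in
  slr_cost w chi g (A + t *: D) (b + t *: d) =
    slr_cost w chi g A b
    + (t ^+ 2 * (\sum_(i < N) w i * ((e i)^T *m e i) 0 0)
       - 2 * t * (\sum_(i < N) w i * ((r i)^T *m e i) 0 0)).
Proof.
move=> e; rewrite /slr_cost !mulr_sumr -sumrB -big_split /=.
apply: eq_bigr => i _.
have -> : slr_residual chi g (A + t *: D) (b + t *: d) i = r i - t *: e i.
  rewrite /slr_residual /e mulmxDl -scalemxAl scalerDr.
  by rewrite addrACA opprD addrA.
move: (r i) (e i) => u v.
have vu : (v^T *m u) 0 0 = (u^T *m v) 0 0.
  by rewrite -{1}[u]trmxK -trmx_mul mxE.
rewrite [(_ - _)^T]linearB /= [(_ *: _)^T]linearZ /= mulmxBl !mulmxBr.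
rewrite -!scalemxAl -!scalemxAr.
move: (u^T *m u) (u^T *m v) (v^T *m u) (v^T *m v) vu => uu uv vu vv vu_uv.
by rewrite !mxE vu_uv; ring.
Qed.

Hypothesis Ab_min : slr_minimizer w chi g A b.

Lemma slr_residual_orthogonal (D : 'M[R]_(p, n)) (d : 'cV[R]_p) :
  \sum_(i < N) w i * ((r i)^T *m (D *m chi i + d)) 0 0 = 0.
Proof.
apply: quadratic_ge0_linear_coef_eq0 => t.
by have := Ab_min (A + t *: D) (b + t *: d); rewrite slr_cost_perturb lerDl; exact.
Qed.

Lemma slr_residual_sum : \sum_(i < N) w i *: r i = 0.
Proof.
apply/colP => j; rewrite summxE [RHS]mxE.
(* Moving only the [j]-th entry of [b] isolates the [j]-th coordinate of the residuals. *)
rewrite -[RHS](slr_residual_orthogonal 0 (delta_mx j 0)).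
by apply: eq_bigr => i _; rewrite mul0mx add0r -colE !mxE.
Qed.

Lemma slr_residual_chi : \sum_(i < N) w i *: (r i *m (chi i)^T) = 0.
Proof.
apply/matrixP => j k; rewrite summxE [RHS]mxE.
(* Moving only the entry [(j, k)] of [A] isolates the product of coordinate [j] of the residual and
   coordinate [k] of the sample; the elementary matrix is then split into column times row. *)
rewrite -[RHS](slr_residual_orthogonal (delta_mx j k) 0).
apply: eq_bigr => i _; rewrite addr0 mulmxA -(mul_delta_mx (0 : 'I_1)).
rewrite mulmxA -colE -mulmxA -rowE !mxE !big_ord1 !mxE //.
Qed.

Hypothesis w_sum : \sum_(i < N) w i = 1.

Lemma slr_mean_eq : slr_mean w chi A b = ut_mean w chi g.
Proof.
(* With [b] spread over the weights and the null residual sum added, the two means agree term by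
   term. *)
have bE : b = \sum_(i < N) w i *: b by rewrite -scaler_suml w_sum scale1r.
rewrite /slr_mean /ut_mean /wmean {1}bE -[LHS]addr0.
rewrite -[X in _ + X = _]slr_residual_sum mulmx_sumr -!big_split /=.
apply: eq_bigr => i _.
by rewrite -scalemxAr -!scalerDr /slr_residual addrC subrK.
Qed.

Lemma slr_cov_eq : slr_cov w chi g A b = ut_cov w chi g.
Proof.
rewrite /slr_cov /ut_cov /wcov -/(ut_mean w chi g) -slr_mean_eq.
set m := wmean w chi.
(* Centring the samples at [m] changes nothing, because the weighted residuals sum to zero. *)
have cross : \sum_(i < N) w i *: (r i *m (chi i - m)^T) = 0.
  under eq_bigr => i _ do rewrite linearB /= mulmxBr scalerBr !scalemxAl.
  rewrite sumrB -mulmx_suml slr_residual_sum mul0mx subr0.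
  under eq_bigr => i _ do rewrite -scalemxAl.
  exact: slr_residual_chi.
have crossA : \sum_(i < N) w i *: (r i *m (A *m (chi i - m))^T) = 0.
  under eq_bigr => i _ do rewrite trmx_mul mulmxA scalemxAl.
  by rewrite -mulmx_suml cross mul0mx.
have crossA' : \sum_(i < N) w i *: (A *m (chi i - m) *m (r i)^T) = 0.
  apply: trmx_inj; rewrite trmx0 -[RHS]crossA linear_sum /=.
  by apply: eq_bigr => i _; rewrite linearZ /= trmx_mul trmxK.
rewrite /slr_error_cov mulmx_sumr mulmx_suml.
(* Both null cross sums are inserted, so that each summand becomes the expansion of the outer square
   of [A *m (chi i - m) + r i]. *)
rewrite -[X in X + _]addr0 -[X in _ + X + _]crossA'.
rewrite -[X in X + _]addr0 -[X in _ + X + _]crossA.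
rewrite -!big_split /=; apply: eq_bigr => i _.
have -> : g (chi i) - slr_mean w chi A b = A *m (chi i - m) + r i.
  rewrite /slr_mean /slr_residual -/m mulmxBr.
  by apply/colP => j; rewrite !mxE; ring.
rewrite -scalemxAr -scalemxAl -!scalerDr; congr (_ *: _).
move: (r i) (chi i - m) => u v.
rewrite [(_ + _)^T]linearD /= mulmxDr !mulmxDl trmx_mul !mulmxA.
by rewrite addrA; congr (_ + _); rewrite addrAC.
Qed.

End NormalEquations.

Theorem theorem1 (R : realType) (n p : nat) (n_gt0 : (0 < n)%N)
    (xhat : 'cV[R]_n) (P L : 'M[R]_n)
    (P_cov : covariance_matrix P) (L_sqrt : matrix_sqrt (n%:R *: P) L)
    (g : 'cV[R]_n -> 'cV[R]_p)
    (Ahat : 'M[R]_(p, n)) (bhat : 'cV[R]_p) :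
  let w := @sigma_weight R n in
  let chi := sigma_point xhat L in
  slr_minimizer w chi g Ahat bhat ->
  slr_mean w chi Ahat bhat = ut_mean w chi g /\
  slr_cov w chi g Ahat bhat = ut_cov w chi g.
Proof.
move=> w chi Ab_min; have w_sum := sigma_weight_sum R n n_gt0.
by split; [apply: slr_mean_eq | apply: slr_cov_eq].
Qed.
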